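(* Let $C\subset\mathbb{CP}^2$ be the irreducible curve of degree $m$ given by the determinantal representation $\Delta(x)=\det(x_0D_0+x_1D_1+x_2D_2)$, with $D_0,D_1,D_2$ complex Hermitian $m\times m$ matrices. Two homogeneous polynomials $p,q$ of degree $n$ in $(x_0,x_1,x_2)$ have a common zero on $C$ if and only if $\det S(p,q)=0$, where $S(p,q)$ is the Sylvester matrix of $p$ and $q$ along $C$.
   Context: Setting: $D_0,D_1,D_2$ are Hermitian and $\Delta$ is irreducible, with real coefficients; $C=\{\Delta=0\}\subset\mathbb{CP}^2$. Spaces: $W_N$ is the space of families $(w_i)_{i\in\mathbb{Z}_{\ge0}^3,|i|=N-1}$, $w_i\in\mathbb{C}^m$, where $|i|=i_0+i_1+i_2$. The principal subspace is $V_N=\{(w_i)\in W_N: D_0w_{j_0+1,j_1,j_2}+D_1w_{j_0,j_1+1,j_2}+D_2w_{j_0,j_1,j_2+1}=0\ \forall |j|=N-2\}$; it has dimension $Nm$. Matrix of shifts: for $p$ homogeneous of degree $n$, $T(p)$ is the $\frac{n(n+1)}{2}\times\frac{2n(2n+1)}{2}$ matrix whose row indexed by $i$, $|i|=n-1$, consists of the coefficients of $x^ip(x)$ with respect to the monomials of degree $2n-1$. Put $\bar T(p)=T(p)\otimes I_m:W_{2n}\to W_n$; it maps $V_{2n}$ into $V_n$, and $T'(p)=\bar T(p)|_{V_{2n}}:V_{2n}\to V_n$. The Sylvester matrix along $C$ is $S(p,q)=\begin{pmatrix} T'(p) \\ T'(q) \end{pmatrix}:V_{2n}\to V_n\oplus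 V_n$, a $2nm\times2nm$ matrix after choosing bases of $V_{2n}$ and $V_n$ (vanishing of its determinant does not depend on the bases). *)

(* Defs.v *)
From HB Require Import structures.
From mathcomp Require Import all_boot all_order all_algebra ring.
From mathcomp Require Import reals complex mpoly.

Set Implicit Arguments.
Unset Strict Implicit.
Unset Printing Implicit Defensive.

Import Order.TTheory GRing.Theory Num.Theory.
Local Open Scope ring_scope.

(* Irreducible element of the domain {mpoly F[k]}; 0 is excluded by the last
   clause (0 = 0 * 0), nonzero constants by the first. *)
Definition mirreducible (F : fieldType) (k : nat) (f : {mpoly F[k]}) : Prop :=
  f \isn't a GRing.unit /\
  forall g h : {mpoly F[k]}, f = g * h ->
    g \is a GRing.unit \/ h \is a GRing.unit.

(* Multi-indices i in (Z_{>=0})^3 with |i| = N - 1; empty for N = 0. *)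
Definition midx (N : nat) := {i : 'X_{1..3 < N} | (mdeg i).+1 == N}.
HB.instance Definition _ N := Finite.on (midx N).

Definition mon N (i : midx N) : 'X_{1..3} := bmnm (val i).

Lemma mon_deg N (i : midx N) : (mdeg (mon i)).+1 = N.
Proof. exact/eqP/(valP i). Qed.

Lemma mon_inj N : injective (@mon N).
Proof. by move=> i j e; do 2 apply: val_inj. Qed.

Lemma midx_exists N (i : 'X_{1..3}) (h : (mdeg i).+1 == N) :
  exists i' : midx N, mon i' = i.
Proof.
have h1 : (mdeg i < N)%N by rewrite (eqP h).
by exists (exist _ (BMultinom h1) h).
Qed.

Fact raise_deg N (j : midx N.-1) (k : 'I_3) : (mdeg (mon j + U_(k))%MM).+1 == N.
Proof. by case: N j => [|N] j; rewrite mdegD mdeg1 addn1 mon_deg //; case: j => -[]. Qed.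

Fact raise_lt N (j : midx N.-1) (k : 'I_3) : (mdeg (mon j + U_(k))%MM < N)%N.
Proof. by rewrite (eqP (raise_deg j k)). Qed.

(* j + e_k, for |j| = N - 2 *)
Definition raise N (j : midx N.-1) (k : 'I_3) : midx N :=
  exist _ (BMultinom (raise_lt j k)) (raise_deg j k).

Lemma mon_raise N (j : midx N.-1) k : mon (raise j k) = (mon j + U_(k))%MM.
Proof. by []. Qed.

(* W_N *)
Definition families (F : fieldType) (m N : nat) := {ffun midx N -> 'cV[F]_m}.
HB.instance Definition _ F m N := Vector.on (families F m N).

Section Sylvester.
Variables (F : fieldType) (m : nat).
Local Notation families := (families F m).

Variable D : 'I_3 -> 'M[F]_m.

Definition detrep : {mpoly F[3]} :=
  \det (\sum_(k < 3) 'X_k *: map_mx (@mpolyC 3 F) (D k)).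

Definition recurrence N (w : families N) : families N.-1 :=
  [ffun j => \sum_(k < 3) D k *m w (raise j k)].

Fact recurrence_linear N : linear (@recurrence N).
Proof.
move=> a u v; apply/ffunP=> j; rewrite !ffunE scaler_sumr -big_split /=.
by apply: eq_bigr => k _; rewrite !ffunE mulmxDr scalemxAr.
Qed.
HB.instance Definition _ N :=
  GRing.isLinear.Build F (families N) (families N.-1) _ (@recurrence N)
    (@recurrence_linear N).

(* V_N *)
Definition principal N : {vspace families N} := lker (linfun (@recurrence N)).

Lemma principalP N (w : families N) :
  w \in principal N <->
  forall j : midx N.-1, \sum_(k < 3) D k *m w (raise j k) = 0.
Proof.
rewrite memv_ker lfunE /=; split=> [/eqP/ffunP h j|h].
  by have := h j; rewrite !ffunE.
by apply/eqP/ffunP=> j; rewrite !ffunE h.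
Qed.

Variable n : nat.

(* T(p): row i, column l holds the coefficient of x^l in x^i p. *)
Definition shiftmx (p : {mpoly F[3]}) :
    'M[F]_(#|{: midx n}|, #|{: midx (2 * n)}|) :=
  \matrix_(i, l) ('X_[mon (enum_val i)] * p)@_(mon (enum_val l)).

(* T(p) tensor I_m, acting from W_{2n} to W_n *)
Definition shiftop (p : {mpoly F[3]}) (w : families (2 * n)) : families n :=
  [ffun i => \sum_l shiftmx p (enum_rank i) (enum_rank l) *: w l].

Section Bases.
(* The source dimension 2nm is written n * m + n * m so that stacking two
   nm-row blocks gives a square matrix. *)
Variables (B2 : (n * m + n * m).-tuple (families (2 * n)))
          (B1 : (n * m).-tuple (families n)).

(* Matrix of T'(p) : V_{2n} -> V_n in a basis B2 of V_{2n} and a basis B1 of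
   V_n; column j holds the coordinates of the image of the j-th vector. *)
Definition restrmx (p : {mpoly F[3]}) : 'M[F]_(n * m, n * m + n * m) :=
  \matrix_(i, j) coord B1 i (shiftop p (tnth B2 j)).

Definition sylvester (p q : {mpoly F[3]}) : 'M[F]_(n * m + n * m) :=
  col_mx (restrmx p) (restrmx q).

End Bases.

(* A point of the projective plane is given by a nonzero coordinate vector. *)
Definition common_zero_on_curve (p q : {mpoly F[3]}) : Prop :=
  exists x : 'I_3 -> F,
    [/\ exists k, x k != 0, detrep.@[x] = 0, p.@[x] = 0 & q.@[x] = 0].

End Sylvester.

Lemma raise_inj N k : injective (fun j : midx N.-1 => raise j k).
Proof.
move=> i j /(congr1 (@mon N)); rewrite /mon /= => /(can_inj (addmK _)).
exact: mon_inj.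
Qed.

Lemma sum_raise (V : zmodType) N k (G : midx N -> V) :
  (forall l, (mon l) k = 0%N -> G l = 0) ->
  \sum_l G l = \sum_(j : midx N.-1) G (raise j k).
Proof.
move=> G0; pose h (l : midx N) := [pick j : midx N.-1 | raise j k == l].
rewrite (bigID (fun l : midx N => mon l k == 0%N)) /= big1 ?add0r; last first.
  by move=> l /eqP/G0.
rewrite (reindex_omap (fun j : midx N.-1 => raise j k) h) => [|l lk].
  apply: eq_bigl => j; rewrite /h /mon /= mnmDE mnm1E eqxx addn1 /=.
  by case: pickP => [i /eqP/raise_inj ->|/(_ j)]; rewrite eqxx.
rewrite /h; case: pickP => [j /eqP <- //|no].
have le1 : (U_(k) <= mon l)%MM.
  apply/mnm_lepP=> i; rewrite mnm1E; case: eqP => // <-.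
  by rewrite lt0n.
have e := submK le1.
have [|j ej] := @midx_exists N.-1 (mon l - U_(k))%MM.
  rewrite -{2}(mon_deg l) -{2}e mdegD mdeg1 addn1 /=.
  by [].
by case/negP: (negbT (no j)); apply/eqP/mon_inj; rewrite {1}/mon /= ej.
Qed.

Lemma shiftop_principal (F : fieldType) m (D : 'I_3 -> 'M[F]_m) n p w :
  w \in principal D (2 * n) -> shiftop p w \in principal D n.
Proof.
move=> /principalP hw; apply/principalP=> j.
transitivity (\sum_(l : midx (2 * n).-1)
   ('X_[mon j] * p)@_(mon l) *: \sum_(k < 3) D k *m w (raise l k)).
  under [RHS]eq_bigr => l _ do rewrite scaler_sumr.
  rewrite exchange_big; apply: eq_bigr => k _ /=.
  rewrite ffunE mulmx_sumr (sum_raise (k := k)) => [|l lk].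
    apply: eq_bigr => l _; rewrite mxE !enum_rankK -scalemxAr; congr (_ *: _).
    rewrite /mon /= mpolyXD mulrAC -/(mon j) -/(mon l).
    by rewrite [(mon l + _)%MM]addmC mcoeffMX.
  rewrite mxE !enum_rankK /mon /= mpolyXD mulrAC -/(mon l).
  rewrite memN_msupp_eq0 ?scale0r ?mulmx0 // (perm_mem (msuppMX _ _)).
  by apply/mapP=> -[i _ e]; move: lk; rewrite e mnmDE mnm1E eqxx.
by rewrite big1 // => l _; rewrite hw scaler0.
Qed.

Lemma card_midx d : #|{: midx d.+1}| = 'C(d + 2, 2).
Proof.
pose b := [seq s2m t | t : d.-tuple 'I_3 <- enum (basis 3 d)].
have <- : size b = 'C(d + 2, 2) by rewrite size_basis -[RHS]bin_sub ?leq_addl // addnK.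
rewrite cardE -(size_map (@mon d.+1)); apply/perm_size/uniq_perm.
- by rewrite map_inj_uniq ?enum_uniq //; exact: mon_inj.
- exact: uniq_basis.
move=> i; rewrite -basis_cover; apply/mapP/eqP=> [[l _ ->]|e].
  by have [] := mon_deg l.
have [|l <-] := @midx_exists d.+1 i; first by rewrite e.
by exists l; rewrite ?mem_enum.
Qed.

Lemma card_midxB N : #|{: midx N}| = (#|{: midx N.-1}| + N)%N.
Proof.
have c0 : #|{: midx 0}| = 0%N by apply: eq_card0 => -[].
case: N => [|[|d]] /=; rewrite ?c0 //.
  by rewrite card_midx.
by rewrite !card_midx addSn binS bin1 addn2 addnC.
Qed.

(* The coefficients of a Hermitian determinantal polynomial are real. *)
Lemma detrep_real (C : numClosedFieldType) m (D : 'I_3 -> 'M[C]_m) :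
  (forall k, D k \is hermsymmx) -> forall i, (detrep D)@_i \is Num.real.
Proof.
move=> hD i; apply/CrealP; rewrite -mcoeff_map_mpoly; congr (_@__).
rewrite /detrep -det_map_mx -[RHS]det_tr; congr (\det _).
rewrite map_mx_sum raddf_sum; apply: eq_bigr => k _ /=.
apply/matrixP=> a b; rewrite !mxE rmorphM /= map_mpolyX map_mpolyC; congr (_ * _%:MP).
have /is_hermitianmxP := hD k => /matrixP/(_ b a) ->.
by rewrite expr0 scale1r !mxE.
Qed.

(* V_N has dimension N m when Delta is nonzero. *)
Section Dimension.
Variables (F : fieldType) (m : nat) (D : 'I_3 -> 'M[F]_m).
Hypothesis D_neq0 : detrep D != 0.
Variable N : nat.

Let W := families F m.
Let pencil : 'M[{mpoly F[3]}]_m :=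
  \sum_(k < 3) 'X_k *: map_mx (@mpolyC 3 F) (D k).
Let unitv M (l : midx M) (v : 'cV[F]_m) : W M := [ffun i => if i == l then v else 0].

Lemma families_sum M (w : W M) : w = \sum_l unitv l (w l).
Proof.
apply/ffunP=> i; rewrite sum_ffunE (bigD1 i) //= ffunE eqxx big1 ?addr0 // => l.
by rewrite ffunE eq_sym => /negPf ->.
Qed.

Lemma recurrence_functional (f : {linear W N.-1 -> F^o}) :
  (forall w : W N, f (recurrence D w) = 0) -> forall w, f w = 0.
Proof.
move=> f0.
pose e (a : 'I_m) : 'cV[F]_m := delta_mx a 0.
pose Y : 'rV[{mpoly F[3]}]_m :=
  \row_a \sum_(j : midx N.-1) f (unitv j (e a)) *: 'X_[mon j].
have fu M (g : {linear W M -> F^o}) l v : g (unitv l v) = \sum_a v a 0 * g (unitv l (e a)).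
  transitivity (g (\sum_a v a 0 *: unitv l (e a))).
    congr (g _); apply/ffunP=> i; rewrite sum_ffunE ffunE.
    case: (eqVneq i l) => [->|ne].
      rewrite {1}[v]matrix_sum_delta; apply: eq_bigr => a _.
      by rewrite big_ord1 !ffunE eqxx.
    by rewrite big1 // => a _; rewrite !ffunE (negPf ne) scaler0.
  by rewrite linear_sum; apply: eq_bigr => a _; rewrite linearZ.
have Y0 : Y *m pencil = 0.
  apply/rowP=> b; rewrite mxE.
  transitivity (\sum_(l : midx N) f (recurrence D (unitv l (e b))) *: 'X_[mon l]
                 : {mpoly F[3]}); last first.
    by rewrite mxE big1 // => l _; rewrite f0 scale0r.
  pose g k (j : midx N.-1) := f (unitv j (D k *m e b)).
  transitivity (\sum_(k < 3) \sum_(j : midx N.-1) g k j *: 'X_[mon (raise j k)]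
                 : {mpoly F[3]}).
    under eq_bigr => a _ do rewrite /pencil summxE mulr_sumr.
    rewrite exchange_big; apply: eq_bigr => k _ /=.
    under eq_bigr => a _ do rewrite !mxE mulr_suml.
    rewrite exchange_big; apply: eq_bigr => j _ /=.
    rewrite /g fu scaler_suml; apply: eq_bigr => a _.
    rewrite mon_raise mpolyXD.
    have -> : (D k *m e b) a 0 = D k a b by rewrite -colE mxE.
    by rewrite -!mul_mpolyC mpolyCM; ring.
  have recE l : f (recurrence D (unitv l (e b))) =
      \sum_(k < 3) \sum_(j : midx N.-1) (if raise j k == l then g k j else 0).
    rewrite [recurrence D _]families_sum linear_sum exchange_big /=.
    apply: eq_bigr => j _.
    transitivity (f (\sum_(k < 3) unitv j (D k *m unitv l (e b) (raise j k)))).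
      congr (f _); apply/ffunP=> i; rewrite sum_ffunE !ffunE.
      case: (eqVneq i j) => [->|ne].
        by apply: eq_bigr => k _; rewrite [in RHS]ffunE eqxx.
      by rewrite big1 // => k _; rewrite ffunE (negPf ne).
    rewrite linear_sum; apply: eq_bigr => k _; rewrite [unitv l _ _]ffunE.
    case: eqP => // _; rewrite mulmx0 -[RHS](linear0 f); congr (f _).
    by apply/ffunP=> i; rewrite !ffunE if_same.
  under [RHS]eq_bigr => l _ do rewrite recE scaler_suml.
  rewrite [RHS]exchange_big; apply: eq_bigr => k _ /=.
  under [RHS]eq_bigr => l _ do rewrite scaler_suml.
  rewrite [RHS]exchange_big; apply: eq_bigr => j _ /=.
  rewrite (bigD1 (raise j k)) //= eqxx big1 ?addr0 // => l.
  by rewrite eq_sym => /negPf ->; rewrite scale0r.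
have Yd : Y = 0.
  apply/rowP=> a; apply/eqP; rewrite [X in _ == X]mxE.
  have : (Y *m (pencil *m \adj pencil)) 0 a = 0 by rewrite mulmxA Y0 mul0mx mxE.
  rewrite mul_mx_adj mul_mx_scalar mxE => /eqP.
  by rewrite mulf_eq0 (negPf D_neq0).
move=> w; rewrite (families_sum w) linear_sum big1 // => j _.
rewrite fu big1 // => a _.
suff -> : f (unitv j (e a)) = (Y 0 a)@_(mon j) by rewrite Yd mxE mcoeff0 mulr0.
rewrite mxE raddf_sum (bigD1 j) //= mcoeffZ mcoeffX eqxx mulr1.
rewrite big1 ?addr0 // => l /negPf lj.
by rewrite mcoeffZ mcoeffX (inj_eq (@mon_inj _)) lj mulr0.
Qed.

Lemma dim_families M : \dim {:W M} = (#|{: midx M}| * m)%N.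
Proof. rewrite dimvf; by rewrite -[in RHS](muln1 m). Qed.

Lemma dim_principal : \dim (principal D N) = (N * m)%N.
Proof.
have full : limg (linfun (@recurrence _ _ D N)) = fullv.
  apply/eqP; rewrite eqEsubv subvf; apply/subvP=> w _.
  set U := limg _.
  suff -> : w = projv U w by exact: memv_proj.
  apply/ffunP=> j; apply/colP=> a; apply/eqP; rewrite -subr_eq0.
  have lin : linear (fun v : W N.-1 => v j a 0 - projv U v j a 0 : F^o).
    move=> c u v; rewrite linearP !ffunE !mxE /=.
    by rewrite opprD addrACA scalerBr.
  pose h := GRing.isLinear.Build F (W N.-1) F^o _ _ lin.
  pose f : {linear W N.-1 -> F^o} := HB.pack (fun v : W N.-1 => v j a 0 - projv U v j a 0 : F^o) h.
  apply/eqP/(@recurrence_functional f) => v.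
  rewrite /f /= projv_id ?subrr //.
  by rewrite -[recurrence D v]lfunE memv_img ?memvf.
have := limg_ker_dim (linfun (@recurrence _ _ D N)) fullv.
rewrite capfv full !dim_families (card_midxB N) mulnDl.
by rewrite addnC => /addnI.
Qed.
End Dimension.

(* Main.v *)
(* det S(p,q) = 0 iff some nonzero w in V_{2n} satisfies p w = q w = 0, where
   V_N is dual to the degree N - 1 part of the cokernel of the pencil
   x_0 D_0 + x_1 D_1 + x_2 D_2.  A common zero x gives w_i = x^i v with v in the
   kernel of the pencil at x.

   Conversely, assume there is no common zero and pick e off C.  On the affine
   plane a + t b + y e the pencil vanishes for y = L(t), where
   L(t) = - D(e)^-1 (D(a) + t D(b)); so polynomials act on F[t]^m by commuting
   matrices P(t), Q(t), and a common kernel vector at some t would give a common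
   zero.  After replacing p by p + c q, the coefficient of t^n in P is
   invertible: as c varies, p + c q can vanish at each of the finitely many
   points of C on the line b + y e for one c only.  A relation
   r P + s Q = 0 with r, s of degree < n forces s to be a multiple of P, because
   the roots of det P can be cancelled one at a time, hence r = s = 0 by degree.
   So the 2nm functionals "multiply by p or q, then contract" are independent on
   the 2nm-dimensional V_{2n}, and they all vanish on w. *)
Require Import Defs.
From HB Require Import structures.
From mathcomp Require Import all_boot all_order all_algebra.
From mathcomp Require Import boolp reals complex mpoly.

Set Implicit Arguments.
Unset Strict Implicit.
Unset Printing Implicit Defensive.

Import Order.TTheory GRing.Theory Num.Theory.
Local Open Scope ring_scope.

(** * Kronecker substitution and expansion of ternary forms in monomials *)

(** It keeps the exponents of distinct monomials distinct under the substitution made in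
    [mpoly_nonroot]. *)
Lemma base_digits_inj (B n : nat) (f g : 'I_n -> nat) :
  (forall i, f i < B)%N -> (forall i, g i < B)%N ->
  (\sum_i f i * B ^ i = \sum_i g i * B ^ i)%N -> f =1 g.
Proof.
elim: n f g => [|n IHn] f g fB gB; first by move=> _ [].
have step (h : 'I_n.+1 -> nat) :
    (\sum_i h i * B ^ i = (\sum_i h (lift ord0 i) * B ^ i) * B + h ord0)%N.
  rewrite big_ord_recl muln1 addnC; congr (_ + _)%N.
  by rewrite big_distrl; apply: eq_bigr => i _; rewrite lift0 expnSr mulnA.
rewrite !step => E.
have e0 : f ord0 = g ord0.
  by have := congr1 (modn^~ B) E; rewrite !modnMDl !modn_small.
move: E; rewrite e0 => /addIn/eqP; rewrite eqn_pmul2r; last first.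
  by apply: leq_trans (fB ord0).
move/eqP/IHn => E i; case: (unliftP ord0 i) => [j ->|-> //].
by rewrite E.
Qed.

(* Kronecker substitution: x_i := t^(B^i) with B larger than every exponent. *)
Lemma mpoly_nonroot (F : closedFieldType) n (g : {mpoly F[n]}) :
  g != 0 -> exists x, g.@[x] != 0.
Proof.
move=> g0; pose B := msize g; pose e (l : 'X_{1..n}) := (\sum_(i < n) l i * B ^ i)%N.
pose f : {poly F} := \sum_(l <- msupp g) g@_l *: 'X^(e l).
have lB l i : l \in msupp g -> (l i < B)%N.
  move=> /msize_mdeg_lt; apply: leq_ltn_trans.
  by rewrite mdegE (bigD1 i) //= leq_addr.
have [l0 l0g] : exists l, l \in msupp g.
  by move: g0; rewrite -msupp_eq0; case: (msupp g) => // l s _; exists l; rewrite mem_head.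
have /closed_nonrootP[t] : f != 0.
  apply: contraTneq l0g => f0; rewrite mcoeff_msupp negbK.
  have : f`_(e l0) = 0 by rewrite f0 coef0.
  rewrite /f coef_sum => /eqP; apply: contraTT => nz.
  have l0g : l0 \in msupp g by rewrite mcoeff_msupp.
  rewrite (bigD1_seq l0) ?msupp_uniq //= coefZ coefXn eqxx mulr1.
  rewrite big_seq_cond big1 ?addr0 // => l /andP[lg ne]; rewrite coefZ coefXn.
  case: eqP => [/base_digits_inj E|_]; last by rewrite mulr0.
  case/eqP: ne; apply/mnmP => i; apply/esym/E => j; exact: lB.
rewrite rootE => ft; exists (fun i => t ^+ (B ^ i)); suff <- : f.[t] = g.@[fun i => t ^+ (B ^ i)] by [].
rewrite /meval /mmap /f horner_sum; apply: eq_bigr => l _.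
rewrite hornerZ hornerXn /mmap1 /e; congr (_ * _).
rewrite expr_sum; apply: eq_bigr => i _.
by rewrite -exprM mulnC.
Qed.

Lemma dhomog_midx (F : fieldType) d (g : {mpoly F[3]}) :
  g \is d.-homog -> g = \sum_(l : midx d.+1) g@_(mon l) *: 'X_[mon l].
Proof.
move=> /dhomogP hg; apply/mpolyP => i; rewrite raddf_sum /=.
under eq_bigr => l _ do rewrite mcoeffZ mcoeffX.
case: (boolP (i \in msupp g)) => [/hg/= e|].
  have [|l <-] := @midx_exists d.+1 i; first by rewrite e.
  rewrite (bigD1 l) //= eqxx mulr1 big1 ?addr0 // => k /negPf kl.
  by rewrite (inj_eq (@mon_inj _)) kl mulr0.
rewrite mcoeff_msupp negbK => /eqP i0; rewrite i0 big1 // => l _.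
by case: eqP => [->|_]; rewrite ?i0 ?mul0r ?mulr0.
Qed.

(** * Row vectors annihilated by matrix polynomials, and degrees of polynomial matrices *)

(** The polynomials in [L] that kill [u] form an ideal, containing the characteristic polynomial by
    Cayley-Hamilton. Bezout puts the gcd of all three in it; as [u] is nonzero, that gcd is not a
    nonzero constant, so it has a root. *)
Lemma common_root_horner_mx (F : closedFieldType) m (L : 'M[F]_m.+1)
    (u : 'rV_m.+1) (f g : {poly F}) :
  u != 0 -> u *m horner_mx L f = 0 -> u *m horner_mx L g = 0 ->
  exists y, [/\ root (char_poly L) y, root f y & root g y].
Proof.
move=> u0 uf ug; pose h := gcdp (char_poly L) (gcdp f g).
have ann (f1 g1 : {poly F}) : u *m horner_mx L f1 = 0 -> u *m horner_mx L g1 = 0 ->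
    u *m horner_mx L (gcdp f1 g1) = 0.
  move=> uf1 ug1; have [[v w] /= /eqp_dvdr E] := Bezoutp f1 g1.
  have /dvdpP[c ->] : v * f1 + w * g1 %| gcdp f1 g1 by rewrite -E.
  have z (k s : {poly F}) : u *m horner_mx L s = 0 -> u *m horner_mx L (k * s) = 0.
    by move=> us; rewrite mulrC rmorphM /= mulmxA us mul0mx.
  by apply: (z c); rewrite rmorphD mulmxDr !z ?addr0.
have uh : u *m horner_mx L h = 0.
  by apply: ann (ann _ _ uf ug); rewrite Cayley_Hamilton mulmx0.
have /closed_rootP[y hy] : size h != 1.
  apply: contra_eqN uh => /size_poly1P[c c0 ->].
  by rewrite horner_mx_C mul_mx_scalar scaler_eq0 negb_or c0.
by exists y; move: hy; rewrite !root_gcd => /and3P[-> -> ->].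
Qed.

(* At a root t of d both P and Q kill v(t), so ('X - t) divides v and can be
   cancelled from d s = v P. *)
Lemma row_mulmx_cancel_roots (F : closedFieldType) m (P Q : 'M[{poly F}]_m.+1)
    (d : {poly F}) (r s v : 'rV[{poly F}]_m.+1) :
  d != 0 -> (forall w : 'rV_m.+1, w *m P = 0 -> w = 0) ->
  P *m Q = Q *m P -> r *m P + s *m Q = 0 ->
  (forall t (u : 'rV[F]_m.+1), u *m map_mx (horner_eval t) P = 0 ->
     u *m map_mx (horner_eval t) Q = 0 -> u = 0) ->
  d *: s = v *m P -> exists w, s = w *m P.
Proof.
move=> + Pinj PQ rs nz; have [k] := ubnP (size d).
elim: k d v => // k IHk d v sdk d0 dsv.
have [/closed_rootP[t /factor_theorem[d' dE]]|] := boolP (size d != 1); last first.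
  rewrite negbK => /size_poly1P[c c0 dE]; exists (c^-1%:P *: v).
  by rewrite -scalemxAl -dsv dE scalerA -polyCM mulVf // scale1r.
(* Right multiplication by the injective [P] turns this into v P Q = - d r P, and v P is d s. *)
have vQ : v *m Q = - (d *: r).
  apply/eqP; rewrite -subr_eq0 opprK; apply/eqP/Pinj.
  rewrite mulmxDl -mulmxA -PQ mulmxA -dsv -!scalemxAl -scalerDr addrC.
  by rewrite rs scaler0.
have [dt] : d.[t] = 0 by rewrite dE hornerM hornerXsubC subrr mulr0.
have vt : map_mx (horner_eval t) v = 0.
  apply: (nz t); rewrite -map_mxM; last rewrite vQ.
    by rewrite -dsv map_mxZ /= /horner_eval dt scale0r.
  by rewrite map_mxN map_mxZ /= /horner_eval dt scale0r oppr0.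
have [v' vE] : exists v', v = ('X - t%:P) *: v'.
  exists (\row_j (v 0 j %/ ('X - t%:P))); apply/rowP => j; rewrite !mxE mulrC divpK //.
  by rewrite dvdp_XsubCl rootE; have /rowP/(_ j) := vt; rewrite !mxE /horner_eval => ->.
have d'0 : d' != 0 by apply: contraNneq d0 => d'0; rewrite dE d'0 mul0r.
apply: (IHk d' v') => //.
  by move: sdk; rewrite dE size_Mmonic ?monicXsubC // size_XsubC addn2.
apply/rowP => j; apply: (@mulfI _ ('X - t%:P)); first by rewrite polyXsubC_eq0.
move: dsv; rewrite vE dE mulrC -scalerA -scalemxAl => /rowP/(_ j).
by rewrite !mxE.
Qed.

(** [C] may have zero entries: [d] only bounds the degrees, which makes the notion stable under sums
    and products. *)
Definition top_coef (F : fieldType) m n d (A : 'M[{poly F}]_(m, n)) (C : 'M[F]_(m, n)) :=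
  forall i j, (size (A i j) <= d.+1)%N /\ (A i j)`_d = C i j.

Lemma top_coefM (F : fieldType) m n k d e (A : 'M[{poly F}]_(m, n)) (B : 'M_(n, k)) C E :
  top_coef d A C -> top_coef e B E -> top_coef (d + e) (A *m B) (C *m E).
Proof.
move=> hA hB i j; rewrite !mxE; split.
  apply: (leq_trans (size_sum _ _ _)); apply/bigmax_leqP => l _.
  apply: (leq_trans (size_polyMleq _ _)).
  have [sA _] := hA i l; have [sB _] := hB l j.
  by have := leq_add sA sB; rewrite addnS addSn; case: (_ + _)%N.
rewrite coef_sum; apply: eq_bigr => l _.
have [sA <-] := hA i l; have [sB <-] := hB l j.
have hd : (d < (d + e).+1)%N by rewrite ltnS leq_addr.
rewrite coefM (bigD1 (Ordinal hd)) //= addKn big1 ?addr0 // => c ne.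
have [lt_dc|] := ltnP d c; first by rewrite nth_default ?mul0r ?(leq_trans sA).
rewrite leq_eqVlt => /orP[/eqP ce|lt_cd]; first by case/eqP: ne; apply: val_inj.
rewrite [(B l j)`__]nth_default ?mulr0 // (leq_trans sB) //.
by rewrite ltn_subRL ltn_add2r.
Qed.

(** If v had degree k, the coefficient of t^(k+n) in v P would be the top coefficient of v times the
    invertible [C], hence nonzero, against the degree bound. *)
Lemma row_mulmx_top_coef (F : fieldType) m n (P : 'M[{poly F}]_m) C (v : 'rV_m) :
  top_coef n P C -> C \in unitmx ->
  (forall j, size ((v *m P) 0%R j) <= n)%N -> v = 0.
Proof.
move=> hP uC svP; pose d := (\max_j size (v 0%R j))%N.
have sv j : (size (v 0%R j) <= d)%N by exact: (leq_bigmax j).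
have v0 j : d = 0%N -> v 0 j = 0.
  by move=> d0; apply/eqP; rewrite -size_poly_leq0 (leq_trans (sv j)) ?d0.
case: (posnP d) => [d0|d_gt0]; first by apply/rowP => j; rewrite mxE v0.
have m_gt0 : (0 < #|'I_m|)%N.
  rewrite card_ord lt0n; apply: contraTneq d_gt0 => m0; rewrite lt0n negbK /d.
  by apply/eqP; move: v {svP sv v0} @d; rewrite m0 => w d; rewrite /d big_ord0.
have [j dj] := bigop.eq_bigmax (fun j => size (v 0 j)) m_gt0.
rewrite -/d in dj; clearbody d.
have hv : top_coef d.-1 v (map_mx (coefp d.-1) v).
  by move=> i k; rewrite ord1 mxE prednK.
have : map_mx (coefp d.-1) v *m C = 0.
  apply/rowP => k; have [_ <-] := top_coefM hv hP 0 k.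
  by rewrite [RHS]mxE nth_default // (leq_trans (svP k)) ?leq_addl.
move/(congr1 (mulmx^~ (invmx C))); rewrite mulmxK // mul0mx.
move/rowP/(_ j)/eqP; rewrite !mxE /= dj -/(lead_coef _) lead_coef_eq0.
by rewrite -size_poly_eq0 -dj -leqn0 leqNgt d_gt0.
Qed.

(** * Ternary polynomials on a line z + y e, with a matrix in place of y *)

Section LineEvaluation.
Variables (F : fieldType) (S : comNzRingType) (iota : {rmorphism F -> S}).
Variables (m : nat) (z e : 'I_3 -> S).

(** The ring [S] is left open so that one construction serves both a fixed line, over [F], and a
    line moving with t, over the polynomials in t. *)
Definition on_line : {mpoly F[3]} -> {poly S} :=
  mmap (polyC \o iota) (fun k => (z k)%:P + (e k)%:P * 'X).
HB.instance Definition _ := GRing.RMorphism.copy on_line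
  (mmap (polyC \o iota) (fun k => (z k)%:P + (e k)%:P * 'X)).

Lemma on_lineZ c g : on_line (c *: g) = (iota c)%:P * on_line g.
Proof. exact: mmapZ. Qed.

Definition line_mx (L : 'M[S]_m.+1) (g : {mpoly F[3]}) : 'M[S]_m.+1 :=
  horner_mx L (on_line g).

Variable L : 'M[S]_m.+1.
HB.instance Definition _ := GRing.RMorphism.copy (line_mx L) (horner_mx L \o on_line).

Lemma line_mxX k : line_mx L 'X_k = (z k)%:M + e k *: L.
Proof.
rewrite /line_mx /on_line mmapX mmap1U rmorphD rmorphM /=.
by rewrite !horner_mx_C horner_mx_X -mul_scalar_mx.
Qed.

Lemma line_mxZ c g : line_mx L (c *: g) = iota c *: line_mx L g.
Proof. by rewrite /line_mx on_lineZ rmorphM /= horner_mx_C -mul_scalar_mx. Qed.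

Lemma line_mxMC g h : line_mx L g *m line_mx L h = line_mx L h *m line_mx L g.
Proof. by rewrite -!/(_ * _) -!rmorphM mulrC. Qed.

End LineEvaluation.

Lemma meval_detrep (F : fieldType) m (D : 'I_3 -> 'M[F]_m) x :
  (detrep D).@[x] = \det (\sum_k x k *: D k).
Proof.
rewrite /detrep -det_map_mx; congr (\det _).
rewrite map_mx_sum; apply: eq_bigr => k _; rewrite map_mxZ /= mevalXU; congr (_ *: _).
by apply/matrixP => i j; rewrite !mxE /= mevalC.
Qed.

Lemma rmorph_mmap (R : nzRingType) n (S T : comNzRingType) (phi : {rmorphism S -> T})
    (f : R -> S) (f' : R -> T) h h' (g : {mpoly R[n]}) :
  (forall c, phi (f c) = f' c) -> (forall i, phi (h i) = h' i) ->
  phi (mmap f h g) = mmap f' h' g.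
Proof.
move=> ff hh; rewrite /mmap rmorph_sum; apply: eq_bigr => l _.
rewrite rmorphM ff rmorph_prod; congr (_ * _); apply: eq_bigr => i _.
by rewrite rmorphXn hh.
Qed.

Lemma top_coef_sum (F : fieldType) m n d (I : Type) (r : seq I)
    (A : I -> 'M[{poly F}]_(m, n)) C :
  (forall i, top_coef d (A i) (C i)) -> top_coef d (\sum_(i <- r) A i) (\sum_(i <- r) C i).
Proof.
move=> h; apply: (big_ind2 (top_coef d)) => [i j|A1 C1 A2 C2 h1 h2 i j|i _ //].
  by rewrite !mxE size_poly0 coef0.
rewrite !mxE coefD; have [s1 <-] := h1 i j; have [s2 <-] := h2 i j; split=> //.
by rewrite (leq_trans (size_polyD _ _)) // geq_max s1.
Qed.

Lemma top_coefX (F : fieldType) m (A : 'M[{poly F}]_m.+1) C n :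
  top_coef 1 A C -> top_coef n (A ^+ n) (C ^+ n).
Proof.
move=> h; elim: n => [i j|n IHn].
  rewrite !expr0 !mxE; case: eqP => _; rewrite ?size_poly1 ?size_poly0 //.
    by rewrite coef1.
  by rewrite coef0.
by rewrite !exprS; apply: (top_coefM h IHn).
Qed.

(** * The pencil on the lines through e and on the plane a + t b + y e *)

Section Core.
Variables (F : closedFieldType) (m : nat) (D : 'I_3 -> 'M[F]_m.+1) (e : 'I_3 -> F).
Hypothesis e_off : \sum_k e k *: D k \in unitmx.

(** The matrix value of y that annihilates the pencil at x + y e. Writing D(x) for the pencil at x,
    it solves D(e) y = - D(x). *)
Definition slope (x : 'I_3 -> F) : 'M[F]_m.+1 :=
  - (invmx (\sum_k e k *: D k) *m \sum_k x k *: D k).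

Lemma mulmx_slope x : (\sum_k e k *: D k) *m slope x = - \sum_k x k *: D k.
Proof. by rewrite /slope mulmxN mulKVmx. Qed.

Definition line_val x := line_mx idfun x e (slope x).
HB.instance Definition _ x := GRing.RMorphism.copy (line_val x) (line_mx idfun x e (slope x)).

Lemma line_valZ x c g : line_val x (c *: g) = c *: line_val x g.
Proof. exact: line_mxZ. Qed.

Lemma horner_on_line x g y : (on_line idfun x e g).[y] = g.@[fun k => x k + y * e k].
Proof.
rewrite -horner_evalE /on_line /meval.
apply: rmorph_mmap => [c|k]; rewrite /= /horner_eval !hornerE //.
by rewrite mulrC.
Qed.

(** The pencil at x + y e factors as D(e) (y - [slope x]), so each eigenvalue of [slope x] is the
    parameter of a point of C on the line. *)
Lemma detrep_char_poly x y :
  root (char_poly (slope x)) y -> (detrep D).@[fun k => x k + y * e k] = 0.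
Proof.
move=> cy; rewrite meval_detrep.
have -> : \sum_k (x k + y * e k) *: D k = (\sum_k e k *: D k) *m (y%:M - slope x).
  rewrite mulmxBr mulmx_slope opprK mul_mx_scalar scaler_sumr addrC -big_split.
  by apply: eq_bigr => k _; rewrite scalerDl scalerA.
rewrite det_mulmx; move: cy.
rewrite rootE /char_poly -horner_evalE -det_map_mx => /eqP.
rewrite /char_poly_mx map_mxD map_mxN map_scalar_mx /= /horner_eval hornerX -map_mx_comp.
by rewrite map_mx_id => [->|c]; rewrite ?mulr0 //= hornerC.
Qed.

Lemma line_val_common_zero x (u : 'rV_m.+1) p q :
  u != 0 -> u *m line_val x p = 0 -> u *m line_val x q = 0 ->
  exists y, let pt := fun k => x k + y * e k in
    [/\ (detrep D).@[pt] = 0, p.@[pt] = 0 & q.@[pt] = 0].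
Proof.
move=> u0 up uq; have [y [cy py qy]] := common_root_horner_mx u0 up uq.
by exists y; split; [exact: detrep_char_poly| |]; rewrite -horner_on_line; apply/eqP.
Qed.

(* Only finitely many points of C lie on the line through x and e; at each of
   them at most one value of c makes p + c q vanish. *)
Lemma line_val_unit x p q :
  (forall y, let pt := fun k => x k + y * e k in
     [/\ (detrep D).@[pt] = 0, p.@[pt] = 0 & q.@[pt] = 0] -> False) ->
  exists c, line_val x (p + c *: q) \in unitmx.
Proof.
move=> nz; have [r rE] := closed_field_poly_normal (char_poly (slope x)).
pose pt y k := x k + y * e k.
(* In the variable c, [f y] is the value of p + c q at [pt y]; it is not identically zero at an
   eigenvalue y. *)
pose f y : {poly F} := (p.@[pt y])%:P + (q.@[pt y]) *: 'X.
pose g : {poly F} := \prod_(y <- r | root (char_poly (slope x)) y) f y.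
have /closed_nonrootP[c gc] : g != 0.
  rewrite prodf_seq_neq0; apply/allP => y _; apply/implyP => cy; apply/eqP => fy0.
  apply: (nz y); split; first exact: detrep_char_poly.
    by have := congr1 (coefp 0) fy0; rewrite /= coefD coefC coefZ coefX mulr0 addr0 coef0.
  by have := congr1 (coefp 1) fy0; rewrite /= coefD coefC coefZ coefX mulr1 add0r coef0.
exists c; rewrite unitmxE unitfE; apply/negP => /det0P[u u0 uc].
have [y [cy]] := common_root_horner_mx u0 uc uc.
rewrite rootE horner_on_line mevalD mevalZ => /eqP pqy _.
move: gc; rewrite rootE horner_prod => /negP[]; apply/eqP.
have yr : y \in r.
  move: (cy); rewrite rE rootZ ?lead_coef_eq0 ?root_prod_XsubC //.
  by apply: contraTneq (char_poly_monic (slope x)) => ->; rewrite monicE lead_coef0 eq_sym oner_eq0.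
rewrite (big_rem y) //= cy /f !hornerE [_ * c]mulrC pqy mul0r //.
Qed.

Variables a b : 'I_3 -> F.

Definition plane_coord k : {poly F} := (a k)%:P + (b k)%:P * 'X.
Definition plane_slope : 'M[{poly F}]_m.+1 :=
  map_mx polyC (slope a) + 'X *: map_mx polyC (slope b).

(* x_k acts as (a_k + b_k t) I + e_k L(t), with L = plane_slope. *)
Definition plane_val := line_mx polyC plane_coord (polyC \o e) plane_slope.
HB.instance Definition _ := GRing.RMorphism.copy plane_val
  (line_mx polyC plane_coord (polyC \o e) plane_slope).

Lemma plane_valZ c g : plane_val (c *: g) = c%:P *: plane_val g.
Proof. exact: line_mxZ. Qed.

Lemma slopeD c x y : slope (fun k => x k + c * y k) = slope x + c *: slope y.
Proof.
rewrite /slope scalerN -opprD; congr (- _); rewrite scalemxAr -mulmxDr; congr (_ *m _).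
rewrite scaler_sumr -big_split; apply: eq_bigr => k _ /=.
by rewrite scalerDl scalerA.
Qed.

(** [slope] is linear in the point, so freezing t in the plane leaves the line through a + t b in
    direction e. *)
Lemma horner_plane_val t g :
  map_mx (horner_eval t) (plane_val g) = line_val (fun k => a k + t * b k) g.
Proof.
rewrite /plane_val /line_val /line_mx map_horner_mx; congr (horner_mx _ _).
  rewrite slopeD /plane_slope; apply/matrixP => i j.
  by rewrite !mxE /= /horner_eval !hornerE.
apply: rmorph_mmap => [c|k] /=; first by rewrite map_polyC /= /horner_eval hornerC.
rewrite rmorphD rmorphM /= !map_polyC map_polyX /= /plane_coord /horner_eval !hornerE.
by rewrite [t * _]mulrC.
Qed.

(** Each x_k acts with degree at most 1 in t, with t-coefficient b_k + e_k [slope b], its value on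
    the line through b. For a form of degree n, taking the coefficient of t^n thus amounts to
    replacing a + t b by b. *)
Lemma plane_val_top n g : g \is n.-homog -> top_coef n (plane_val g) (line_val b g).
Proof.
have top1 k : top_coef 1 (plane_val 'X_k) (line_val b 'X_k).
  rewrite /plane_val /line_val !line_mxX /plane_slope.
  move: (slope a) (slope b) => sa sb i j; rewrite !mxE /= /plane_coord.
  set c1 := sa i j; set c2 := sb i j.
  have -> : (a k)%:P + (b k)%:P * 'X = (a k)%:P + b k *: 'X by rewrite mul_polyC.
  have -> : (e k)%:P * (c1%:P + 'X * c2%:P) = (e k * c1)%:P + (e k * c2) *: 'X.
    by rewrite mulrDr -polyCM ['X * _]mulrC mulrA -polyCM mul_polyC.
  have sz (c d : F) : (size (c%:P + d *: 'X)%R <= 2)%N.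
    rewrite (leq_trans (size_polyD _ _)) // geq_max (leq_trans (size_polyC_leq1 _)) //.
    by rewrite (leq_trans (size_scale_leq _ _)) ?size_polyX.
  split; last by rewrite coefD coefMn !coefD !coefC !coefZ coefX /= !mulr1 !add0r.
  rewrite (leq_trans (size_polyD _ _)) // geq_max sz andbT.
  by case: (i == j); rewrite ?mulr0n ?size_poly0 ?mulr1n ?sz.
move=> /dhomog_midx ->; rewrite !raddf_sum; apply: top_coef_sum => l.
rewrite /= plane_valZ line_valZ.
suff top_mon : top_coef n (plane_val 'X_[mon l]) (line_val b 'X_[mon l]).
  move=> i j; rewrite mxE [in RHS]mxE mul_polyC coefZ.
  have [s <-] := top_mon i j; split=> //.
  by rewrite (leq_trans (size_scale_leq _ _)).
have : mdeg (mon l) = n by have [] := mon_deg l.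
move: (mon l) => {}l <-.
rewrite mpolyXE_id mdegE !rmorph_prod.
(* The empty product is handled as the zeroth power of an arbitrary variable. *)
apply: (big_ind3 (fun A C d => top_coef d A C)); first exact: (top_coefX 0 (top1 ord0)).
  by move=> *; apply: top_coefM.
by move=> k _; rewrite !rmorphXn; apply: top_coefX.
Qed.

(** This is D(a) + t D(b) + D(e) L(t) = 0, the defining property of L; it yields the recurrence of
    V_N for coefficients of plane values. *)
Lemma pencil_plane_val : \sum_k map_mx polyC (D k) *m plane_val 'X_k = 0.
Proof.
pose E x := map_mx polyC (\sum_k x k *: D k) : 'M[{poly F}]_m.+1.
have EE x : E x = \sum_k (x k)%:P *: map_mx polyC (D k).
  by rewrite /E map_mx_sum; apply: eq_bigr => k _; rewrite map_mxZ.
have Es x : E e *m map_mx polyC (slope x) = - E x.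
  by rewrite -map_mxM mulmx_slope map_mxN.
transitivity (E a + 'X *: E b + E e *m plane_slope).
  rewrite !EE scaler_sumr mulmx_suml -!big_split; apply: eq_bigr => k _ /=.
  rewrite /plane_val line_mxX mulmxDr mul_mx_scalar -scalemxAr -scalemxAl.
  by rewrite /plane_coord scalerDl scalerA ['X * _]mulrC.
rewrite mulmxDr -scalemxAr !Es scalerN addrACA subrr add0r.
by rewrite subrr.
Qed.

Lemma plane_val_syzygy n p q (r s : 'rV[{poly F}]_m.+1) :
  p \is n.-homog -> q \is n.-homog ->
  line_val b p \in unitmx ->
  (forall t y, let pt := fun k => (a k + t * b k) + y * e k in
     [/\ (detrep D).@[pt] = 0, p.@[pt] = 0 & q.@[pt] = 0] -> False) ->
  (forall j, size (r 0%R j) <= n)%N -> (forall j, size (s 0%R j) <= n)%N ->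
  r *m plane_val p + s *m plane_val q = 0 -> r = 0 /\ s = 0.
Proof.
move=> hp hq up nz sr ss rs.
have row0 := row_mulmx_top_coef (plane_val_top hp) up.
have Pinj (w : 'rV_m.+1) : w *m plane_val p = 0 -> w = 0.
  by move=> w0; apply: row0 => j; rewrite w0 mxE size_poly0.
suff s0 : s = 0 by split=> //; apply: Pinj; move: rs; rewrite s0 mul0mx addr0.
have d0 : \det (plane_val p) != 0.
  by apply/negP => /det0P[w w0 /Pinj wz]; rewrite wz eqxx in w0.
(* The adjugate starts the cancellation: with P the plane value of p, det P times s is (s adj P)
   P. *)
have [|t u pu qu||w sE] := @row_mulmx_cancel_roots _ _ (plane_val p) (plane_val q)
    (\det (plane_val p)) r s (s *m \adj (plane_val p)) d0 Pinj _ rs.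
- exact: line_mxMC.
- apply/eqP/idPn => u0.
  rewrite horner_plane_val in pu; rewrite horner_plane_val in qu.
  by have [y] := line_val_common_zero u0 pu qu; apply: nz.
- by rewrite -mulmxA mul_adj_mx mul_mx_scalar.
have w0 : w = 0 by apply: row0 => j; rewrite -sE.
by rewrite sE w0 mul0mx.
Qed.

End Core.

(** * Pairing forms with families *)

Section Contraction.
Variables (F : fieldType) (m : nat).

(** Pairing of forms of degree N - 1 with families, for which [shiftop p] is the transpose of
    multiplication by [p]. Coefficients in other degrees are dropped. *)
Definition contract N (g : {mpoly F[3]}) (w : families F m N) : 'cV[F]_m :=
  \sum_(l : midx N) g@_(mon l) *: w l.

Lemma contract_suml N (I : Type) (r : seq I) (g : I -> {mpoly F[3]}) (w : families F m N) :
  contract (\sum_(i <- r) g i) w = \sum_(i <- r) contract (g i) w.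
Proof.
rewrite exchange_big; apply: eq_bigr => l _.
by rewrite raddf_sum scaler_suml.
Qed.

Lemma contractZl N c g (w : families F m N) : contract (c *: g) w = c *: contract g w.
Proof. by rewrite scaler_sumr; apply: eq_bigr => l _; rewrite mcoeffZ scalerA. Qed.

Fact contract_linear N g : linear (@contract N g).
Proof.
move=> c v w; rewrite scaler_sumr -big_split; apply: eq_bigr => l _ /=.
by rewrite !ffunE scalerDr !scalerA mulrC.
Qed.
HB.instance Definition _ N g :=
  GRing.isLinear.Build F (families F m N) 'cV[F]_m _ (@contract N g) (contract_linear g).

Lemma shiftopE n p (w : families F m (2 * n)) i :
  shiftop p w i = contract ('X_[mon i] * p) w.
Proof. by rewrite ffunE; apply: eq_bigr => l _; rewrite mxE !enum_rankK. Qed.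

Lemma contract_shiftop n h p (w : families F m (2 * n)) :
  (0 < n)%N -> h \is n.-1.-homog -> contract h (shiftop p w) = contract (h * p) w.
Proof.
move=> n0 /dhomog_midx; rewrite prednK // => hE.
rewrite [in RHS]hE mulr_suml contract_suml; apply: eq_bigr => i _.
by rewrite shiftopE -scalerAl contractZl.
Qed.

Lemma shiftop_lin n c p q (w : families F m (2 * n)) :
  shiftop (p + c *: q) w = shiftop p w + c *: shiftop q w.
Proof.
apply/ffunP => i; rewrite !ffunE scaler_sumr -big_split; apply: eq_bigr => l _ /=.
by rewrite !mxE mulrDr mcoeffD -scalerAr mcoeffZ scalerDl scalerA.
Qed.

Lemma shiftop_sum n p (I : Type) (r : seq I) c (w : I -> families F m (2 * n)) :
  shiftop p (\sum_(i <- r) c i *: w i) = \sum_(i <- r) c i *: shiftop p (w i).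
Proof.
apply/ffunP => i; rewrite shiftopE linear_sum sum_ffunE.
by apply: eq_bigr => k _; rewrite linearZ ffunE shiftopE.
Qed.

End Contraction.

(** * The kernel of the Sylvester matrix, and the kernel vector given by a common zero *)

Section SylvesterKernel.
Variables (F : fieldType) (m n : nat) (D : 'I_3 -> 'M[F]_m) (p q : {mpoly F[3]}).
Variables (B2 : (n * m + n * m).-tuple (families F m (2 * n)))
          (B1 : (n * m).-tuple (families F m n)).
Hypotheses (B2_basis : basis_of (principal D (2 * n)) B2)
           (B1_basis : basis_of (principal D n) B1).

Lemma restrmx_mul (c : 'cV[F]_(n * m + n * m)) g i :
  (restrmx B2 B1 g *m c) i 0 = coord B1 i (shiftop g (\sum_j c j 0 *: tnth B2 j)).
Proof.
rewrite mxE shiftop_sum linear_sum; apply: eq_bigr => j _.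
by rewrite linearZ /= mxE mulrC.
Qed.

(** Coordinates in [B1] lose nothing, because [shiftop g] maps V_{2n} into V_n, which [B1] spans. *)
Lemma restrmx_ker (c : 'cV[F]_(n * m + n * m)) g :
  restrmx B2 B1 g *m c = 0 <-> shiftop g (\sum_j c j 0 *: tnth B2 j) = 0.
Proof.
set w := \sum_j _; have wV : w \in principal D (2 * n).
  apply: rpred_sum => j _; apply: rpredZ; apply: (basis_mem B2_basis).
  exact: mem_tnth.
split=> [E|E]; last by apply/colP => i; rewrite restrmx_mul E linear0 mxE.
rewrite (coord_basis B1_basis (shiftop_principal g wV)) big1 // => i _.
by rewrite -restrmx_mul E mxE scale0r.
Qed.

Lemma det_sylvester_eq0 :
  \det (sylvester B2 B1 p q) = 0 <->
  exists w, [/\ w \in principal D (2 * n), w != 0, shiftop p w = 0 & shiftop q w = 0].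
Proof.
split=> [/eqP|[w [wV w0 pw qw]]].
  rewrite -det_tr => /det0P[u u0 /(congr1 trmx)]; rewrite trmx_mul trmxK trmx0.
  rewrite /sylvester mul_col_mx -[X in _ = X]col_mx0 => /eq_col_mx[/restrmx_ker pw /restrmx_ker qw].
  exists (\sum_j u^T j 0 *: tnth B2 j); split=> //.
    apply: rpred_sum => j _; apply: rpredZ; apply: (basis_mem B2_basis).
    exact: mem_tnth.
  apply: contraNneq u0 => w0; apply/eqP/rowP => j.
  have /freeP/(_ (fun j => u^T j 0)) := basis_free B2_basis.
  move=> /(_ _ j); rewrite !mxE => -> //.
  by rewrite -[RHS]w0; apply: eq_bigr => i _; rewrite (tnth_nth 0).
pose c : 'cV[F]_(n * m + n * m) := \col_j coord B2 j w.
have cw : \sum_j c j 0 *: tnth B2 j = w.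
  rewrite [RHS](coord_basis B2_basis wV); apply: eq_bigr => j _.
  by rewrite mxE (tnth_nth 0).
apply/eqP; rewrite -det_tr; apply/det0P; exists c^T.
  apply: contraNneq w0 => /(congr1 trmx); rewrite trmxK trmx0 => c0.
  by rewrite -cw c0 big1 // => j _; rewrite mxE scale0r.
rewrite -trmx_mul /sylvester mul_col_mx.
have -> : restrmx B2 B1 p *m c = 0 by apply/restrmx_ker; rewrite cw.
have -> : restrmx B2 B1 q *m c = 0 by apply/restrmx_ker; rewrite cw.
by rewrite col_mx0 trmx0.
Qed.

Lemma common_zero_kernel :
  (0 < n)%N -> p \is n.-homog -> q \is n.-homog -> common_zero_on_curve D p q ->
  exists w, [/\ w \in principal D (2 * n), w != 0, shiftop p w = 0 & shiftop q w = 0].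
Proof.
move=> n0 hp hq [x [[k xk] Dx px qx]].
have [u u0 uD] : exists2 u : 'cV[F]_m, u != 0 & (\sum_k x k *: D k) *m u = 0.
  move/eqP: Dx; rewrite meval_detrep -det_tr => /det0P[u u0 uD].
  exists u^T; first by rewrite trmx_eq0.
  by rewrite -[LHS]trmxK trmx_mul trmxK uD trmx0.
have d2 : (n.-1 + n).+1 = (2 * n)%N by rewrite mul2n -addnn -addSn prednK.
pose w : families F m (2 * n) := [ffun l => 'X_[mon l].@[x] *: u].
(* Contracting a form of degree 2n - 1 with [w] gives its value at x times [u], and x^i g vanishes
   at x. *)
have kill g : g \is n.-homog -> g.@[x] = 0 -> shiftop g w = 0.
  move=> hg gx; apply/ffunP => i; rewrite shiftopE [RHS]ffunE.
  have /dhomog_midx : 'X_[mon i] * g \is (n.-1 + n).-homog.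
    apply: dhomogM => //; rewrite dhomogX; apply/eqP/succn_inj.
    by rewrite prednK //; exact: mon_deg.
  rewrite d2 => E.
  transitivity (('X_[mon i] * g).@[x] *: u); last by rewrite mevalM gx mulr0 scale0r.
  rewrite [in RHS]E raddf_sum scaler_suml; apply: eq_bigr => l _.
  by rewrite ffunE /= mevalZ scalerA.
exists w; split; [ | | exact: kill | exact: kill].
  apply/principalP => j.
  transitivity ('X_[mon j].@[x] *: ((\sum_k x k *: D k) *m u)).
    rewrite mulmx_suml scaler_sumr.
    apply: eq_bigr => i _; rewrite ffunE mon_raise mpolyXD mevalM mevalXU.
    by rewrite -scalemxAr -scalemxAl scalerA.
  by rewrite uD scaler0.
(* The entry of [w] at the pure power x_k^(2n-1) is nonzero because the coordinate x_k is. *)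
have [|l lE] := @midx_exists (2 * n) (U_(k) *+ (2 * n).-1)%MM.
  by rewrite mdegMn mdeg1 mul1n prednK // muln_gt0.
apply: contraNneq u0 => /ffunP/(_ l); rewrite !ffunE lE -mpolyXn rmorphXn /= mevalXU.
by move/eqP; rewrite scaler_eq0 expf_eq0 (negPf xk) andbF.
Qed.

End SylvesterKernel.

(** * Independent functionals on the principal subspace *)

(** Both sides have dimension [N]: left separation makes the square Gram matrix [G] injective on
    rows, hence invertible, hence injective on columns. *)
Lemma left_separating_right (F : fieldType) (V : vectType F) N (U : {vspace V})
    (B : N.-tuple V) (phi : 'rV[F]_N -> V -> F^o) :
  basis_of U B -> (forall w, linear (phi^~ w)) -> (forall u, linear (phi u)) ->
  (forall u, (forall w, w \in U -> phi u w = 0) -> u = 0) ->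
  forall w, w \in U -> (forall u, phi u w = 0) -> w = 0.
Proof.
move=> bB hl hr sep w wU wphi.
pose L v : {linear 'rV[F]_N -> F^o} :=
  HB.pack (phi^~ v) (GRing.isLinear.Build F 'rV[F]_N F^o _ _ (hl v)).
pose Rr u : {linear V -> F^o} :=
  HB.pack (phi u) (GRing.isLinear.Build F V F^o _ _ (hr u)).
pose G : 'M[F]_N := \matrix_(i, j) phi (delta_mx 0 i) B`_j.
have phiE u v : v \in U -> phi u v = \sum_j (u *m G) 0 j * coord B j v.
  move=> vU; transitivity (Rr u (\sum_j coord B j v *: B`_j)).
    by rewrite -(coord_basis bB vU).
  rewrite linear_sum; apply: eq_bigr => j _; rewrite linearZ /= mxE mulrC.
  congr (_ * _); transitivity (L B`_j (\sum_i u 0 i *: delta_mx 0 i)).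
    by rewrite -row_sum_delta.
  by rewrite linear_sum; apply: eq_bigr => i _; rewrite linearZ /= mxE.
have Ginj : \det G != 0.
  apply/negP => /det0P[u /eqP u0 uG]; apply/u0/sep => v vU.
  by rewrite phiE // uG big1 // => j _; rewrite mxE mul0r.
pose c : 'cV[F]_N := \col_j coord B j w.
have : G *m c = 0.
  apply/colP => i; rewrite [RHS]mxE -(wphi (delta_mx 0 i)) phiE // mxE.
  by apply: eq_bigr => j _; rewrite -rowE !mxE.
move/(congr1 (mulmx (invmx G))); rewrite mulKmx ?unitmxE ?unitfE // mulmx0 => /colP c0.
rewrite (coord_basis bB wU) big1 // => j _.
by have := c0 j; rewrite !mxE => ->; rewrite scale0r.
Qed.

Section EvaluationFamilies.
Variables (F : closedFieldType) (m : nat) (D : 'I_3 -> 'M[F]_m.+1) (e : 'I_3 -> F).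
Hypothesis e_off : \sum_k e k *: D k \in unitmx.
Variables a b : 'I_3 -> F.
Local Notation plane_val := (plane_val D e a b).

Definition eval_family N d c : families F m.+1 N :=
  [ffun l => \col_i (plane_val 'X_[mon l] i c)`_d].

(* The coefficient of t^d in column c of plane_val is a functional on the
   cokernel of the pencil, i.e. an element of V_N. *)
Lemma eval_family_principal N d c : eval_family N d c \in principal D N.
Proof.
apply/principalP => j; apply/colP => i; rewrite summxE [RHS]mxE.
have /matrixP/(_ i c) := congr1 (mulmx^~ (plane_val 'X_[mon j])) (pencil_plane_val e_off a b).
rewrite mul0mx mulmx_suml summxE [RHS]mxE => /(congr1 (coefp d)).
rewrite /= coef_sum coef0 => E; rewrite -[RHS]E; apply: eq_bigr => k _.
rewrite ffunE mon_raise mpolyXD mulrC rmorphM /= -mulmxA !mxE coef_sum.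
by apply: eq_bigr => l _; rewrite !mxE coefCM.
Qed.

Lemma contract_eval_family n d c g : g \is n.-homog ->
  contract g (eval_family n.+1 d c) = \col_i (plane_val g i c)`_d.
Proof.
move=> /dhomog_midx gE; rewrite {2}gE; apply/colP => i.
rewrite !summxE mxE raddf_sum summxE coef_sum; apply: eq_bigr => l _.
by rewrite ffunE !mxE /= plane_valZ mxE coefCM.
Qed.

(** Row j of [r] is read as the coefficient of t^j in a row of polynomials of degree below n. *)
Lemma row_rVpoly n (r : 'M[F]_(n, m.+1)) :
  \row_c rVpoly (col c r)^T = \sum_(j < n) 'X^j *: map_mx polyC (row j r).
Proof.
apply/rowP => c; rewrite mxE summxE /rVpoly poly_def; apply: eq_bigr => j _.
by rewrite valK !mxE -mul_polyC mulrC.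
Qed.

(** Tested on [eval_family] for all d and c, the relation says that every coefficient of r P + s Q
    vanishes, where r and s are read as rows of polynomials in t and each [h j] supplies the factor
    t^j. [plane_val_syzygy] then applies. *)
Lemma contract_independent n p q (h : 'I_n -> {mpoly F[3]}) (r s : 'M[F]_(n, m.+1)) :
  p \is n.-homog -> q \is n.-homog ->
  line_val D e b p \in unitmx ->
  (forall t y, let pt := fun k => (a k + t * b k) + y * e k in
     [/\ (detrep D).@[pt] = 0, p.@[pt] = 0 & q.@[pt] = 0] -> False) ->
  (forall j, h j \is n.-1.-homog) -> (forall j, plane_val (h j) = ('X^j)%:M) ->
  (forall w, w \in principal D (2 * n) ->
     \sum_j (row j r *m contract (h j * p) w + row j s *m contract (h j * q) w) = 0) ->
  r = 0 /\ s = 0.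
Proof.
move=> hp hq up nz hh hval rel.
case: n => [|n] in p q h r s hp hq up nz hh hval rel *.
  by split; apply/matrixP => -[].
pose v (M : 'M[F]_(n.+1, m.+1)) := \row_c rVpoly (col c M)^T.
have v0 (M : 'M[F]_(n.+1, m.+1)) : v M = 0 -> M = 0.
  move/rowP => M0; apply/matrixP => j c; have := M0 c.
  rewrite !mxE => /(congr1 (coefp j)) /=.
  by rewrite coef_rVpoly_ord !mxE coef0.
have vs (M : 'M[F]_(n.+1, m.+1)) c : (size (v M 0%R c) <= n.+1)%N.
  by rewrite mxE size_poly.
have vmul M g : v M *m plane_val g = \sum_j map_mx polyC (row j M) *m plane_val (h j * g).
  rewrite /v row_rVpoly mulmx_suml; apply: eq_bigr => j _.
  by rewrite rmorphM /= hval -mulmxE mul_scalar_mx -scalemxAr scalemxAl.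
have [r0 s0] : v r = 0 /\ v s = 0; last by split; apply: v0.
apply: (plane_val_syzygy e_off hp hq up nz (vs r) (vs s)).
rewrite !vmul -big_split; apply/rowP => c; apply/polyP => d.
have /rowP/(_ 0) := rel _ (eval_family_principal (2 * n.+1) d c).
rewrite summxE [X in _ = X -> _]mxE => E.
rewrite summxE coef_sum [in RHS]mxE coef0 -[RHS]E.
apply: eq_bigr => j _.
have coef_row (M : 'M[F]_(n.+1, m.+1)) g : g \is n.+1.-homog ->
    ((map_mx polyC (row j M) *m plane_val (h j * g)) 0 c)`_d =
    (row j M *m contract (h j * g) (eval_family (2 * n.+1) d c)) 0 0.
  move=> hg; have d2 : (2 * n.+1)%N = (n + n.+1).+1 by rewrite mul2n -addnn.
  rewrite d2 contract_eval_family ?dhomogM ?hh // !mxE coef_sum.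
  by apply: eq_bigr => i _; rewrite !mxE coefCM.
by rewrite [RHS]mxE -(coef_row r p hp) -(coef_row s q hq) -coefD [in LHS]mxE.
Qed.

End EvaluationFamilies.

(** * From a kernel vector to a common zero *)

Lemma kernel_common_zero (F : closedFieldType) m n (D : 'I_3 -> 'M[F]_m.+1)
    (p q : {mpoly F[3]}) w :
  detrep D != 0 -> (0 < n)%N -> p \is n.-homog -> q \is n.-homog ->
  w \in principal D (2 * n) -> w != 0 -> shiftop p w = 0 -> shiftop q w = 0 ->
  common_zero_on_curve D p q.
Proof.
move=> D0 n0 hp hq wV /eqP w0 pw qw; apply: contrapT => ncz.
(* The factor x_0 forces e_0 to be nonzero besides e lying off C. *)
have [e] : exists e, (detrep D * 'X_0).@[e] != 0.
  by apply: mpoly_nonroot; rewrite mulf_neq0 // -msupp_eq0 msuppX.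
rewrite mevalM mevalXU mulf_eq0 negb_or meval_detrep => /andP[De e0].
have e_off : \sum_k e k *: D k \in unitmx by rewrite unitmxE unitfE.
(* With e_0 nonzero, these two coordinate vectors complete e to a basis, so the plane a + t b + y e
   avoids the origin. *)
pose a (k : 'I_3) : F := (k == 1)%:R; pose b (k : 'I_3) : F := (k == 2)%:R.
have ncp (x : 'I_3 -> F) : (exists k, x k != 0) ->
    [/\ (detrep D).@[x] = 0, p.@[x] = 0 & q.@[x] = 0] -> False.
  by move=> x0 [Dx px qx]; apply: ncz; exists x.
(* Coordinate 0 is y e_0, nonzero unless y = 0, and then coordinate k of x survives. *)
have off (x : 'I_3 -> F) y k : k != 0 -> x 0 = 0 -> x k != 0 ->
    exists i, x i + y * e i != 0.
  move=> k0 x0 xk; have [->|y0] := eqVneq y 0; first by exists k; rewrite mul0r addr0.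
  by exists 0; rewrite x0 add0r mulf_neq0.
have [|c unit_c] := @line_val_unit _ _ D e e_off b p q.
  move=> y; apply: ncp; apply: (off b y 2) => //=.
  by rewrite /b eqxx oner_eq0.
pose pc := p + c *: q.
have hpc : pc \is n.-homog by rewrite rpredD ?rpredZ.
(* A linear form vanishing at e, on which L(t) therefore drops out: [lin 1] acts as 1 and [lin 2] as
   t. *)
pose lin k : {mpoly F[3]} := 'X_k - (e k / e 0) *: 'X_0.
have hlin k : lin k \is 1.-homog.
  by rewrite rpredB ?rpredZ // dhomogX /= mdeg1.
have plin k : plane_val D e a b (lin k) = ((a k)%:P + (b k)%:P * 'X)%:M.
  have z0 : plane_coord a b 0 = 0 by rewrite /plane_coord /a /b /= polyC0 mul0r addr0.
  rewrite rmorphB /= plane_valZ /plane_val !line_mxX z0 raddf0 add0r scalerA /=.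
  by rewrite -polyCM divfK // addrK.
pose h (j : 'I_n) := lin 1 ^+ (n.-1 - j) * lin 2 ^+ j.
have hh j : h j \is n.-1.-homog.
  have jn : (j <= n.-1)%N by rewrite -ltnS prednK.
  rewrite -[n.-1](subnK jn); apply: dhomogM.
    by have := dhomogMn (n.-1 - j) (hlin 1); rewrite mul1n.
  by have := dhomogMn j (hlin 2); rewrite mul1n.
have hval j : plane_val D e a b (h j) = ('X^j)%:M.
  rewrite rmorphM !rmorphXn /= !plin /a /b /= !mul0r !mul1r addr0 add0r.
  by rewrite expr1n mul1r -rmorphXn.
pose R (u : 'rV[F]_(n * m.+1 + n * m.+1)) : 'M[F]_(n, m.+1) := vec_mx (lsubmx u).
pose S (u : 'rV[F]_(n * m.+1 + n * m.+1)) : 'M[F]_(n, m.+1) := vec_mx (rsubmx u).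
(* [u] packs the coefficients of r and s. Their number 2nm is the dimension of V_{2n}, so
   independence of the functionals forces a common zero of all of them to be 0. *)
pose phi u (v : families F m.+1 (2 * n)) : F^o :=
  (\sum_j (row j (R u) *m contract (h j * pc) v + row j (S u) *m contract (h j * q) v)) 0 0.
have dimV := dim_principal D0 (2 * n).
have NE : (2 * n * m.+1 = n * m.+1 + n * m.+1)%N by rewrite -mulnA mul2n addnn.
pose B := tcast (etrans dimV NE) (vbasis (principal D (2 * n))).
have bB : basis_of (principal D (2 * n)) B by rewrite val_tcast; exact: vbasisP.
apply/w0/(left_separating_right (phi := phi) bB) => // [v k u1 u2|u k v1 v2|u uV|u].
- rewrite /phi; set x1 := \sum_j _; set x2 := \sum_j _; set x3 := \sum_j _.
  suff -> : x1 = k *: x2 + x3 by rewrite !mxE.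
  rewrite scaler_sumr -big_split; apply: eq_bigr => j _ /=.
  by rewrite /R /S !linearP !mulmxDl -!scalemxAl scalerDr addrACA.
- rewrite /phi; set x1 := \sum_j _; set x2 := \sum_j _; set x3 := \sum_j _.
  suff -> : x1 = k *: x2 + x3 by rewrite !mxE.
  rewrite scaler_sumr -big_split; apply: eq_bigr => j _ /=.
  by rewrite !linearP scalerDr addrACA.
- have [||Ru Su] := contract_independent e_off hpc hq unit_c _ hh hval (r := R u) (s := S u).
  (* A common zero of [pc] and [q] is one of [p] and [q], and coordinate 1 of a + t b is 1. *)
  + move=> t y /= [Dx px qx]; apply: (@ncp (fun k => a k + t * b k + y * e k)).
      apply: (off (fun k => a k + t * b k) y 1) => //=; rewrite /a /b /=.
        by rewrite mulr0 addr0.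
      by rewrite mulr0 addr0 oner_eq0.
    by split=> //; move: px; rewrite mevalD mevalZ qx mulr0 addr0.
  + by move=> v /uV e1; apply/colP => i; rewrite !ord1 [RHS]mxE.
  rewrite -[u]hsubmxK -[lsubmx u]vec_mxK -[rsubmx u]vec_mxK -/(R u) -/(S u) Ru Su.
  by rewrite raddf0 row_mx0.
have pcw : shiftop pc w = 0 by rewrite shiftop_lin pw qw scaler0 addr0.
rewrite /phi big1 ?mxE // => j _.
rewrite -!contract_shiftop // pcw qw.
by rewrite !linear0 addr0.
Qed.

Theorem corollary2p2 (R : realType) (m n : nat)
    (D : 'I_3 -> 'M[R[i]]_m) (p q : {mpoly R[i][3]})
    (D_hermitian : forall k, D k \is hermsymmx)
    (Delta_irreducible : mirreducible (detrep D))
    (n_gt0 : (0 < n)%N)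
    (p_homog : p \is n.-homog) (q_homog : q \is n.-homog)
    (B2 : (n * m + n * m).-tuple (families R[i] m (2 * n)))
    (B1 : (n * m).-tuple (families R[i] m n))
    (B2_basis : basis_of (principal D (2 * n)) B2)
    (B1_basis : basis_of (principal D n) B1) :
  common_zero_on_curve D p q <-> \det (sylvester B2 B1 p q) = 0.
Proof.
have [D_unit D_fact] := Delta_irreducible.
case: m => [|m'] in D D_hermitian Delta_irreducible D_unit D_fact B2 B1 B2_basis B1_basis *.
  (* For m = 0, Delta is the empty determinant 1, a unit. *)
  by rewrite /detrep det_mx00 unitr1 in D_unit.
have D0 : detrep D != 0.
  apply/eqP => D0; have : detrep D = 0 * 0 by rewrite mulr0.
  by case/D_fact; rewrite unitr0.
split=> [cz|/(det_sylvester_eq0 p q B2_basis B1_basis)[w [wV w0 pw qw]]].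
  exact/(det_sylvester_eq0 p q B2_basis B1_basis)/common_zero_kernel.
exact: kernel_common_zero D0 n_gt0 p_homog q_homog wV w0 pw qw.
Qed.
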